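(* Let $p\ge5$ be prime, $i,j\in\mathbb{N}_0$, $a\in\{2,\dots,(p-1)/2\}$, and let $o_a$ be the multiplicative order of $a(1-a)^{-1}$ in $(\mathbb{Z}/p\mathbb{Z})^*$. Then the $\mathbb{Z}_p$-submodule $\vartheta_a(\mathfrak{p}^i\wedge\mathfrak{p}^j)$ of $K$ (spanned by all $\vartheta_a(x\wedge y)$, $x\in\mathfrak{p}^i$, $y\in\mathfrak{p}^j$) equals $\mathfrak{p}^{i+j+\epsilon(i,j)}$, where $\epsilon(i,j)=1$ if $o_a\mid(i-j)$ and $\epsilon(i,j)=0$ otherwise. In particular $\vartheta_a(\mathfrak{p}^i\wedge\mathfrak{p}^i)=\mathfrak{p}^{2i+1}$, so the restriction of $\vartheta_a$ lies in $\hat H_i$ for all $i\in\mathbb{N}_0$.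
   Context: Let $\theta$ be a primitive $p$-th root of unity, $K=\mathbb{Q}_p(\theta)$, $\mathcal{O}$ its ring of integers, $\mathfrak{p}$ its maximal ideal; $\mathfrak{p}^j$ is the unique ideal of index $p^j$ in $\mathcal{O}$. For $j\in\mathbb{Z}$ prime to $p$, $\sigma_j$ is the Galois automorphism of $K$ with $\theta\mapsto\theta^j$. For $a\in\{2,\dots,(p-1)/2\}$, $\vartheta_a:K\wedge K\to K$ is defined by $\vartheta_a(x\wedge y)=\sigma_a(x)\sigma_{1-a}(y)-\sigma_{1-a}(x)\sigma_a(y)$. $P=\langle\theta\rangle$ acts by multiplication on ideals and diagonally on exterior squares; $\hat{H}_i=\{\gamma\in\mathrm{Hom}_P(\mathfrak{p}^i\wedge\mathfrak{p}^i,\mathfrak{p}^{2i+1}) \mid \gamma \text{ surjective}\}$. *)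

(* Defs.v *)
(* Model of K = Q_p(theta), its integers O = Z_p[theta],
   and the ideals p^k, built as inverse limits O = lim_n Z[X]/(p^n, Phi_p),
   Z_p = lim_n Z/p^n Z (no p-adic library is installed). *)
From HB Require Import structures.
From mathcomp Require Import all_boot all_order all_algebra.
Set Implicit Arguments. Unset Strict Implicit. Unset Printing Implicit Defensive.
Import Order.TTheory GRing.Theory Num.Theory.
Local Open Scope ring_scope.

Definition Phi (p : nat) : {poly int} := \sum_(k < p) 'X^k.

(* f = g in Z[X]/(p^n, Phi_p) = Z[theta]/p^n Z[theta] = O / p^n O. *)
Definition congO (p n : nat) (f g : {poly int}) : Prop :=
  exists q r : {poly int}, f - g = ((p ^ n)%N%:Z)%:P * q + Phi p * r.

Definition Oseq := nat -> {poly int}.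

(* x is a compatible sequence, i.e. an element of O = lim_n O/p^n O. *)
Definition isO (p : nat) (x : Oseq) : Prop :=
  forall n, congO p n (x n.+1) (x n).

Definition eqO (p : nat) (x y : Oseq) : Prop :=
  forall n, congO p n (x n) (y n).

(* c is an element of Z_p = lim_n Z/p^n Z. *)
Definition isZp (p : nat) (c : nat -> int) : Prop :=
  forall n, ((p ^ n)%N%:Z %| c n.+1 - c n)%Z.

Definition mulO (x y : Oseq) : Oseq := fun n => x n * y n.
Definition thetaO : Oseq := fun _ => 'X.

Definition sigmaO (j : nat) (x : Oseq) : Oseq := fun n => (x n) \Po 'X^j.

(* the ideal p^k = pi^k O, pi = 1 - theta a uniformizer of O *)
Definition pideal (p k : nat) (x : Oseq) : Prop :=
  isO p x /\ exists y, isO p y /\ eqO p x (fun n => (1 - 'X) ^+ k * y n).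

(* vartheta_a (x /\ y) = sigma_a(x) sigma_{1-a}(y) - sigma_{1-a}(x) sigma_a(y);
   sigma_{1-a} = sigma_{p+1-a} since theta^p = 1. *)
Definition varthetaO (p a : nat) (x y : Oseq) : Oseq :=
  fun n => sigmaO a x n * sigmaO (p + 1 - a) y n
           - sigmaO (p + 1 - a) x n * sigmaO a y n.

Definition thetaSpan (p a i j : nat) (z : Oseq) : Prop :=
  isO p z /\
  exists (m : nat) (c : 'I_m -> nat -> int) (x y : 'I_m -> Oseq),
    (forall k, isZp p (c k) /\ pideal p i (x k) /\ pideal p j (y k)) /\
    eqO p z (fun n => \sum_(k < m) (c k n)%:P * varthetaO p a (x k) (y k) n).

(* Main.v *)
(* Let [Pi = 1 - theta], a uniformizer of [O = Z_p[theta]], and [b = 1 - a]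
   (mod [p]).  Since [sigma_e(Pi) = Pi * (1 + theta + ... + theta^(e-1))] with a
   unit second factor, [vartheta_a(Pi^i s, Pi^j t) = Pi^(i+j) R] where
   [R(1) = (a^i b^j - b^i a^j) s(1) t(1)].  So the span lies in [p^(i+j+1)]
   exactly when [p] divides [a^i b^j - b^i a^j], that is when
   [(a / (1 - a))^(i-j) = 1] in [F_p], that is when [o_a] divides [i - j].
   Conversely the span is an [O]-module ([vartheta_a(theta x, theta y) =
   theta vartheta_a(x, y)] and [O] is spanned over [Z_p] by powers of [theta]);
   it contains [vartheta_a(Pi^i, theta Pi^j) - theta^a vartheta_a(Pi^i, Pi^j)],
   a unit times [Pi^(i+j+1)], and when [p] does not divide [a^i b^j - b^i a^j]
   also [vartheta_a(Pi^i, Pi^j)], a unit times [Pi^(i+j)] modulo [Pi^(i+j+1)].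
   Elements of [O] are compatible sequences modulo [(p^n, Phi_p)]; cancelling
   [Pi] costs one power of [p] since [p = Phi_p + Pi T]. *)

Require Import Defs.
From mathcomp Require Import all_boot all_order all_algebra.
From mathcomp Require Import ring zify.
From Stdlib Require Import IndefiniteDescription.
Import GRing.Theory.
Set Implicit Arguments. Unset Strict Implicit. Unset Printing Implicit Defensive.
Local Open Scope ring_scope.

Definition Pi : {poly int} := 1 - 'X.

Definition geom (e : nat) : {poly int} := \sum_(k < e) 'X^k.

Lemma mulPi_geom e : Pi * geom e = 1 - 'X^e.
Proof. by rewrite /Pi -opprB mulNr /geom -subrX1 opprB. Qed.

Lemma comp_Pi_Xn e : Pi \Po 'X^e = Pi * geom e.
Proof. by rewrite mulPi_geom rmorphB /= rmorph1 comp_polyX. Qed.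

Lemma horner_geom1 e : (geom e).[1] = e%:Z.
Proof.
rewrite horner_sum (eq_bigr (fun _ => 1)) => [|k _]; last by rewrite hornerXn expr1n.
by rewrite sumr_const card_ord natz.
Qed.

Lemma hornerPi1 : Pi.[1] = 0.
Proof. by rewrite !hornerE subrr. Qed.

Lemma Pi_neq0 : Pi != 0.
Proof. by rewrite /Pi -opprB oppr_eq0 polyXsubC_eq0. Qed.

Section Cyclotomic.
Variable p : nat.
Hypothesis p_pr : prime p.

Lemma Xn_sub1_Phi : 'X^p - 1 = ('X - 1) * Phi p.
Proof. exact: subrX1. Qed.

Lemma horner_Phi1 : (Phi p).[1] = p%:Z.
Proof. exact: horner_geom1. Qed.

Lemma natp_Phi_Pi : exists T, (p%:Z)%:P = Phi p + Pi * T.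
Proof.
have : root (Phi p - (p%:Z)%:P) 1 by rewrite /root !hornerE horner_Phi1 subrr.
case/factor_theorem => T hT; exists T.
by rewrite /Pi -opprB mulNr mulrC -hT opprB addrC subrK.
Qed.

(* [Phi p] and [Pi] are coprime in Q[X] because [Phi p] does not vanish at 1. *)
Lemma Phi_dvd_of_Pi_mul f g : Pi * f = Phi p * g -> exists h, f = Phi p * h.
Proof.
move=> e; have : root g 1.
  have /esym/eqP := congr1 (horner^~ 1) e.
  rewrite !hornerM hornerPi1 mul0r horner_Phi1 mulf_eq0 => /orP[|//].
  by rewrite eqz_nat eqn0Ngt prime_gt0.
case/factor_theorem => h hg; exists (- h).
by apply: (mulfI Pi_neq0); rewrite e hg /Pi; ring.
Qed.

Definition eqPhi (f g : {poly int}) : Prop := exists r, f - g = Phi p * r.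

Lemma eqPhi_Xn_modp N : eqPhi ('X^N) ('X^(N %% p)).
Proof.
exists (('X - 1) * (\sum_(k < N %/ p) ('X^p) ^+ k) * 'X^(N %% p)).
rewrite {1}(divn_eq N p) mulnC exprD exprM -{2}['X^(N %% p)]mul1r -mulrBl.
by rewrite subrX1 Xn_sub1_Phi; ring.
Qed.

Definition unitPhi (u : {poly int}) : Prop := exists v, eqPhi (u * v) 1.

Lemma unitPhi1 : unitPhi 1.
Proof. by exists 1, 0; rewrite mulr1 subrr mulr0. Qed.

Lemma unitPhiM u v : unitPhi u -> unitPhi v -> unitPhi (u * v).
Proof.
move=> [u' [r hr]] [v' [s hs]]; exists (u' * v'), (r * v * v' + s).
have -> : u * v * (u' * v') = (u * u' - 1) * (v * v') + (v * v' - 1) + 1 by ring.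
by rewrite addrK hr hs; ring.
Qed.

Lemma unitPhiX u k : unitPhi u -> unitPhi (u ^+ k).
Proof.
move=> hu; elim: k => [|k IH]; first exact: unitPhi1.
by rewrite exprS; apply: unitPhiM.
Qed.

Lemma unitPhiN u : unitPhi u -> unitPhi (- u).
Proof. by move=> [v hv]; exists (- v); rewrite mulrNN. Qed.

Lemma unitPhi_Xn k : unitPhi ('X^k).
Proof.
exists ('X^(k * p.-1)), (('X - 1) * \sum_(i < k) ('X^p) ^+ i).
rewrite -exprD -{1}(muln1 k) -mulnDr add1n prednK ?prime_gt0 // mulnC exprM.
by rewrite subrX1 Xn_sub1_Phi; ring.
Qed.

Lemma Fp_natE m n : ((m%:R : 'F_p) == n%:R) = (m == n %[mod p]).
Proof. by rewrite -val_eqE /= !val_Fp_nat. Qed.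

Lemma Fp_nat_neq0 e : (0 < e < p)%N -> (e%:R : 'F_p) != 0.
Proof. by move=> /andP[e0 ep]; rewrite -(dvdn_pcharf (pchar_Fp p_pr)) gtnNdvd. Qed.

Lemma unitPhi_geom e : (0 < e < p)%N -> unitPhi (geom e).
Proof.
move=> he; pose f := val ((e%:R : 'F_p)^-1).
have /eqP ef1 : (e * f == 1 %[mod p])%N.
  by rewrite -Fp_natE natrM natr_Zp mulfV // Fp_nat_neq0.
have [r hr] := eqPhi_Xn_modp (e * f); rewrite ef1 modn_small ?prime_gt1 // in hr.
exists (\sum_(k < f) ('X^e) ^+ k).
have /Phi_dvd_of_Pi_mul : Pi * (geom e * \sum_(k < f) ('X^e) ^+ k - 1) = Phi p * - r.
  rewrite mulrBr mulrA mulPi_geom -[1 - 'X^e]opprB mulNr -subrX1 -exprM.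
  by rewrite -[_ ^+ (e * f)](subrK 'X^1) hr /Pi; ring.
by case=> h; exists h.
Qed.

Lemma eqPhi_Pi_of_dvd_horner1 f : (p%:Z %| f.[1])%Z -> exists g, eqPhi f (Pi * g).
Proof.
case/dvdzP => h hf; have [T hT] := natp_Phi_Pi.
have : root (f - (f.[1])%:P) 1 by rewrite /root !hornerE subrr.
case/factor_theorem => q hq; exists (- q + h%:P * T), h%:P.
rewrite -[f](subrK (f.[1])%:P) hq hf polyCM hT /Pi; ring.
Qed.

(* [geom e] is invertible modulo [Phi p] and [geom e * (Phi p \Po 'X^e)] is a
   multiple of [Phi p]. *)
Lemma Phi_comp_Xn e : (0 < e < p)%N -> exists r, Phi p \Po 'X^e = Phi p * r.
Proof.
move=> he; have [v [r hr]] := unitPhi_geom he.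
have key : geom e * (Phi p \Po 'X^e) = Phi p * \sum_(k < e) ('X^p) ^+ k.
  apply: (mulfI Pi_neq0); rewrite mulrA -comp_Pi_Xn -rmorphM /=.
  rewrite {1}/Pi -opprB mulNr -Xn_sub1_Phi rmorphN rmorphB /= rmorph1.
  by rewrite comp_Xn_poly -exprM mulnC exprM subrX1 Xn_sub1_Phi /Pi; ring.
exists (v * \sum_(k < e) ('X^p) ^+ k - r * (Phi p \Po 'X^e)).
transitivity (v * (Phi p * \sum_(k < e) ('X^p) ^+ k) - Phi p * r * (Phi p \Po 'X^e)).
  by rewrite -key -hr; ring.
by ring.
Qed.

Lemma congO_refl n f : congO p n f f.
Proof. by exists 0, 0; rewrite subrr !mulr0 addr0. Qed.

Lemma congO_sym n f g : congO p n f g -> congO p n g f.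
Proof. by move=> [q [r e]]; exists (- q), (- r); rewrite -opprB e; ring. Qed.

Lemma congO_trans n f g h : congO p n f g -> congO p n g h -> congO p n f h.
Proof.
move=> [q1 [r1 e1]] [q2 [r2 e2]]; exists (q1 + q2), (r1 + r2).
by rewrite -[f](subrK g) -addrA e1 e2; ring.
Qed.

Lemma congOD n f1 f2 g1 g2 : congO p n f1 g1 -> congO p n f2 g2 ->
  congO p n (f1 + f2) (g1 + g2).
Proof.
move=> [q1 [r1 e1]] [q2 [r2 e2]]; exists (q1 + q2), (r1 + r2).
have -> : f1 + f2 - (g1 + g2) = (f1 - g1) + (f2 - g2) by ring.
by rewrite e1 e2; ring.
Qed.

Lemma congOB n f1 f2 g1 g2 : congO p n f1 g1 -> congO p n f2 g2 ->
  congO p n (f1 - f2) (g1 - g2).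
Proof.
move=> [q1 [r1 e1]] [q2 [r2 e2]]; exists (q1 - q2), (r1 - r2).
have -> : f1 - f2 - (g1 - g2) = (f1 - g1) - (f2 - g2) by ring.
by rewrite e1 e2; ring.
Qed.

Lemma congOM n f1 f2 g1 g2 : congO p n f1 g1 -> congO p n f2 g2 ->
  congO p n (f1 * f2) (g1 * g2).
Proof.
move=> [q1 [r1 e1]] [q2 [r2 e2]]; exists (q1 * f2 + g1 * q2), (r1 * f2 + g1 * r2).
have -> : f1 * f2 - g1 * g2 = (f1 - g1) * f2 + g1 * (f2 - g2) by ring.
by rewrite e1 e2; ring.
Qed.

Lemma congOMl n f g h : congO p n f g -> congO p n (h * f) (h * g).
Proof. exact/congOM/congO_refl. Qed.

Lemma congO_sum n (I : finType) (F G : I -> {poly int}) :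
  (forall i, congO p n (F i) (G i)) -> congO p n (\sum_i F i) (\sum_i G i).
Proof. by move=> h; apply: big_ind2 => [|*|//]; [apply: congO_refl | apply: congOD]. Qed.

Lemma congO_le m n f g : (m <= n)%N -> congO p n f g -> congO p m f g.
Proof.
move=> le [q [r e]]; exists ((p ^ (n - m))%N%:Z%:P * q), r.
by rewrite mulrA -polyCM -PoszM -expnD subnKC.
Qed.

Lemma congO_eqPhi n f g : eqPhi f g -> congO p n f g.
Proof. by move=> [r e]; exists 0, r; rewrite mulr0 add0r. Qed.

Lemma congO_comp n e f g : (0 < e < p)%N -> congO p n f g ->
  congO p n (f \Po 'X^e) (g \Po 'X^e).
Proof.
move=> he [q [r efg]]; have [s hs] := Phi_comp_Xn he.
exists (q \Po 'X^e), (s * (r \Po 'X^e)).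
by rewrite -rmorphB /= efg rmorphD !rmorphM /= comp_polyC hs mulrA.
Qed.

Lemma congO_Pi_cancel n f g : congO p n.+1 (Pi * f) (Pi * g) -> congO p n f g.
Proof.
move=> [q [r e]]; have [T hT] := natp_Phi_Pi; set c := (p ^ n)%N%:Z%:P.
have : Pi * (f - g - c * q * T) = Phi p * (r + c * q).
  transitivity ((Pi * f - Pi * g) - c * q * (Pi * T)); first by ring.
  by rewrite e expnS PoszM polyCM -[Pi * T](addKr (Phi p)) -hT; ring.
by case/Phi_dvd_of_Pi_mul => h hh; exists (q * T), h; rewrite -hh mulrA subrKC.
Qed.

Lemma congO_PiX_cancel k n f g :
  congO p (n + k) (Pi ^+ k * f) (Pi ^+ k * g) -> congO p n f g.
Proof.
elim: k n f g => [|k IH] n f g; first by rewrite addn0 !expr0 !mul1r.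
by rewrite addnS -addSn !exprSr -!mulrA => /IH/congO_Pi_cancel.
Qed.

End Cyclotomic.

Section Elements.
Variable p : nat.
Hypothesis p_pr : prime p.

Lemma isO_const f : isO p (fun _ => f).
Proof. by move=> n; apply: congO_refl. Qed.

Lemma isOD x y : isO p x -> isO p y -> isO p (fun n => x n + y n).
Proof. by move=> hx hy n; apply: congOD. Qed.

Lemma isOM x y : isO p x -> isO p y -> isO p (fun n => x n * y n).
Proof. by move=> hx hy n; apply: congOM. Qed.

Lemma isO_congO_le x m n : isO p x -> (m <= n)%N -> congO p m (x n) (x m).
Proof.
move=> hx /subnK <-; elim: (n - m)%N => [|k IH]; first exact: congO_refl.
by apply: congO_trans IH; rewrite addSn; apply: congO_le (hx _); apply: leq_addl.
Qed.

Lemma eqO_sym x y : eqO p x y -> eqO p y x.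
Proof. by move=> h n; apply: congO_sym. Qed.

Lemma eqO_trans x y z : eqO p x y -> eqO p y z -> eqO p x z.
Proof. by move=> h1 h2 n; apply: congO_trans (h1 n) (h2 n). Qed.

Lemma isZp_const c : isZp p (fun _ => c).
Proof. by move=> n; rewrite subrr dvdz0. Qed.

Lemma isZpM c d : isZp p c -> isZp p d -> isZp p (fun n => c n * d n).
Proof.
move=> hc hd n.
have -> : c n.+1 * d n.+1 - c n * d n = c n.+1 * (d n.+1 - d n) + (c n.+1 - c n) * d n.
  by ring.
by apply: rpredD; [apply: dvdz_mull | apply: dvdz_mulr].
Qed.

Lemma congO_isZp c n : isZp p c -> congO p n (c n.+1)%:P (c n)%:P.
Proof.
move=> /(_ n)/dvdzP[k hk]; exists k%:P, 0.
by rewrite -polyCB hk polyCM mulr0 addr0 mulrC.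
Qed.

Lemma isO_scale c x : isZp p c -> isO p x -> isO p (fun n => (c n)%:P * x n).
Proof. by move=> hc hx n; apply: congOM => //; apply: congO_isZp. Qed.

Lemma Phi_monic : Phi p \is monic.
Proof.
have := monicXnsubC (1 : int) (prime_gt0 p_pr).
by rewrite Xn_sub1_Phi monicMl // monicXsubC.
Qed.

Lemma size_Phi : size (Phi p) = p.
Proof.
have := size_XnsubC (1 : int) (prime_gt0 p_pr).
rewrite Xn_sub1_Phi size_monicM ?monicXsubC ?monic_neq0 ?Phi_monic //.
by rewrite size_XsubC => -[].
Qed.

Definition coordPhi (u : {poly int}) (k : nat) : int :=
  (Pdiv.CommonRing.rmodp u (Phi p))`_k.

Lemma coordPhi_expand u : eqPhi p u (\sum_(k < p) (coordPhi u k)%:P * 'X^k).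
Proof.
set m := Pdiv.CommonRing.rmodp u (Phi p).
have hm : (size m <= p)%N.
  by rewrite -size_Phi ltnW // Pdiv.CommonRing.ltn_rmodpN0 // monic_neq0 ?Phi_monic.
have -> : \sum_(k < p) (coordPhi u k)%:P * 'X^k = m.
  rewrite -[RHS]coefK poly_def (big_ord_widen _ (fun k => m`_k *: 'X^k) hm).
  rewrite [RHS]big_mkcond /=; apply: eq_bigr => k _; rewrite mul_polyC.
  by case: ifP => // hk; rewrite /coordPhi -/m nth_default ?scale0r // leqNgt hk.
exists (Pdiv.CommonRing.rdivp u (Phi p)).
by rewrite {1}(Pdiv.RingMonic.rdivp_eq Phi_monic u) mulrC addrK.
Qed.

Lemma isZp_coordPhi u k : isO p u -> isZp p (fun n => coordPhi (u n) k).
Proof.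
move=> hu n; have [q [r e]] := hu n; rewrite /coordPhi -coefB.
rewrite -Pdiv.RingMonic.rmodpB ?Phi_monic // e Pdiv.RingMonic.rmodpD ?Phi_monic //.
rewrite [Phi p * r]mulrC Pdiv.RingMonic.rmodp_mull ?Phi_monic // addr0 mul_polyC.
by rewrite Pdiv.RingMonic.rmodpZ ?Phi_monic // coefZ dvdz_mulr.
Qed.

Lemma pideal_const k s : pideal p k (fun _ => Pi ^+ k * s).
Proof.
split; first exact: isO_const.
by exists (fun _ => s); split=> [|n]; [apply: isO_const | apply: congO_refl].
Qed.

(* The level-[(n + k)] witness, once [Pi ^+ k] is cancelled, is compatible at
   level [n]. *)
Lemma pideal_of_congO k z : isO p z ->
  (forall n, exists s, congO p n (z n) (Pi ^+ k * s)) -> pideal p k z.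
Proof.
move=> hz /functional_choice[s hs]; split => //.
exists (fun n => s (n + k)%N); split => n.
  apply: (@congO_PiX_cancel p p_pr k).
  apply: congO_trans (congO_sym (congO_le _ (hs _))) _; first by rewrite addSn.
  by apply: congO_trans (hs _); rewrite addSn; apply: congO_le (hz _).
apply: congO_trans (congO_le (leq_addr k n) (hs _)).
exact/congO_sym/isO_congO_le/leq_addr.
Qed.

End Elements.

Section Vartheta.
Variables p a : nat.
Hypothesis p_pr : prime p.
Local Notation b := (p + 1 - a)%N.
Hypothesis a_range : (0 < a < p)%N.
Hypothesis b_range : (0 < b < p)%N.

Definition vtheta (f g : {poly int}) : {poly int} :=
  (f \Po 'X^a) * (g \Po 'X^b) - (f \Po 'X^b) * (g \Po 'X^a).

Lemma varthetaOE x y n : varthetaO p a x y n = vtheta (x n) (y n).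
Proof. by []. Qed.

Lemma congO_vtheta n f f' g g' : congO p n f f' -> congO p n g g' ->
  congO p n (vtheta f g) (vtheta f' g').
Proof. by move=> hf hg; apply: congOB; apply: congOM; apply: congO_comp. Qed.

Lemma isO_vtheta x y : isO p x -> isO p y -> isO p (varthetaO p a x y).
Proof. by move=> hx hy n; apply: congO_vtheta. Qed.

(* [a + b = p + 1] and [theta^(p + 1) = theta]. *)
Lemma vtheta_mulX f g : eqPhi p (vtheta ('X * f) ('X * g)) ('X * vtheta f g).
Proof.
have ab : (a + b = p.+1)%N by move: a_range => /andP[_ /ltnW]; lia.
exists ('X * ('X - 1) * vtheta f g).
have -> : vtheta ('X * f) ('X * g) = 'X^(a + b) * vtheta f g.
  by rewrite /vtheta !rmorphM /= !comp_polyX exprD; ring.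
by rewrite ab exprS -[_ ^+ p](subrK 1) Xn_sub1_Phi; ring.
Qed.

Definition vtheta_red (i j : nat) (s t : {poly int}) : {poly int} :=
  geom a ^+ i * geom b ^+ j * (s \Po 'X^a) * (t \Po 'X^b)
  - geom b ^+ i * geom a ^+ j * (s \Po 'X^b) * (t \Po 'X^a).

Lemma vtheta_PiX i j s t :
  vtheta (Pi ^+ i * s) (Pi ^+ j * t) = Pi ^+ (i + j) * vtheta_red i j s t.
Proof.
by rewrite /vtheta /vtheta_red !rmorphM /= !rmorphXn /= !comp_Pi_Xn !exprMn exprD; ring.
Qed.

Definition vtheta_coef (i j : nat) : int := (a ^ i * b ^ j)%N%:Z - (b ^ i * a ^ j)%N%:Z.

Lemma horner_vtheta_red1 i j s t :
  (vtheta_red i j s t).[1] = vtheta_coef i j * s.[1] * t.[1].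
Proof.
rewrite /vtheta_red /vtheta_coef !(hornerE, horner_comp, hornerXn, expr1n, horner_geom1).
by rewrite !PoszM -!natz !natrX; ring.
Qed.

End Vartheta.

Section Span.
Variables p a i j : nat.
Hypothesis p_pr : prime p.
Hypothesis a_range : (0 < a < p)%N.
Hypothesis b_range : (0 < p + 1 - a < p)%N.
Local Notation span := (thetaSpan p a i j).

Lemma span_isO z : span z -> isO p z.
Proof. by case. Qed.

Lemma span_eq z z' : span z -> isO p z' -> eqO p z z' -> span z'.
Proof.
move=> [_ [m [c [x [y [H e]]]]]] hz' ez; split => //.
by exists m, c, x, y; split => //; apply: eqO_trans e; apply: eqO_sym.
Qed.

Lemma span_ext z z' : span z -> z =1 z' -> span z'.
Proof.
move=> hz e; have hO := span_isO hz.
by apply: span_eq hz _ _ => n; rewrite -?e; [apply: hO | apply: congO_refl].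
Qed.

Lemma span0 : span (fun _ => 0).
Proof.
split; first exact: isO_const.
exists 0%N, (fun _ _ => 0), (fun _ _ => 0), (fun _ _ => 0); split; first by case.
by move=> n; rewrite big_ord0; apply: congO_refl.
Qed.

Lemma spanD z1 z2 : span z1 -> span z2 -> span (fun n => z1 n + z2 n).
Proof.
move=> [hz1 [m1 [c1 [x1 [y1 [H1 e1]]]]]] [hz2 [m2 [c2 [x2 [y2 [H2 e2]]]]]].
split; first exact: isOD.
pose sel (T : Type) (f1 : 'I_m1 -> T) (f2 : 'I_m2 -> T) (k : 'I_(m1 + m2)) :=
  match split k with inl k1 => f1 k1 | inr k2 => f2 k2 end.
exists (m1 + m2)%N, (sel _ c1 c2), (sel _ x1 x2), (sel _ y1 y2); split.
  by move=> k; rewrite /sel; case: (split k) => k'; [apply: H1 | apply: H2].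
move=> n; rewrite big_split_ord /=; apply: congOD.
  apply: congO_trans (e1 n) _; apply: congO_sum => k.
  by rewrite /sel (unsplitK (inl k)); apply: congO_refl.
apply: congO_trans (e2 n) _; apply: congO_sum => k.
by rewrite /sel (unsplitK (inr k)); apply: congO_refl.
Qed.

Lemma span_sum m (z : 'I_m -> Oseq) :
  (forall k, span (z k)) -> span (fun n => \sum_(k < m) z k n).
Proof.
elim: m z => [|m IH] z h; first by apply: span_ext span0 _ => n; rewrite big_ord0.
apply: span_ext (spanD (IH _ (fun k => h (widen_ord (leqnSn m) k))) (h ord_max)) _.
by move=> n; rewrite big_ord_recr.
Qed.

Lemma span_scale c z : isZp p c -> span z -> span (fun n => (c n)%:P * z n).
Proof.
move=> hc [hz [m [c1 [x [y [H e]]]]]]; split; first exact: isO_scale.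
exists m, (fun k n => c n * c1 k n), x, y; split.
  by move=> k; case: (H k) => h1 h2; split => //; apply: isZpM.
move=> n; apply: congO_trans (congOMl _ (e n)) _; rewrite mulr_sumr.
by apply: congO_sum => k; rewrite polyCM mulrA; apply: congO_refl.
Qed.

Lemma pideal_mulX k x : pideal p k x -> pideal p k (fun n => 'X * x n).
Proof.
move=> [hx [y [hy e]]]; split; first by apply: isOM => //; apply: isO_const.
exists (fun n => 'X * y n); split; first by apply: isOM => //; apply: isO_const.
by move=> n; rewrite mulrCA; apply: congOMl.
Qed.

Lemma span_mulX z : span z -> span (fun n => 'X * z n).
Proof.
move=> [hz [m [c [x [y [H e]]]]]]; split; first by apply: isOM => //; apply: isO_const.
exists m, c, (fun k n => 'X * x k n), (fun k n => 'X * y k n); split.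
  by move=> k; case: (H k) => h1 [h2 h3]; split => //; split; apply: pideal_mulX.
move=> n; apply: congO_trans (congOMl _ (e n)) _; rewrite mulr_sumr.
apply: congO_sum => k; rewrite !varthetaOE mulrCA; apply: congOMl.
exact/congO_sym/congO_eqPhi/vtheta_mulX.
Qed.

Lemma span_mulXn k z : span z -> span (fun n => 'X^k * z n).
Proof.
elim: k => [|k IH] hz; first by apply: span_ext hz _ => n; rewrite mul1r.
by apply: span_ext (span_mulX (IH hz)) _ => n; rewrite exprS mulrA.
Qed.

Lemma span_vtheta x y : pideal p i x -> pideal p j y -> span (varthetaO p a x y).
Proof.
move=> hx hy; split; first by apply: isO_vtheta => //; [case: hx | case: hy].
exists 1%N, (fun _ _ => 1), (fun _ => x), (fun _ => y); split.
  by move=> k; split => //; apply: isZp_const.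
by move=> n; rewrite big_ord1 mul1r; apply: congO_refl.
Qed.

(* Write [u] in the basis [1, X, ..., X^(p-1)]: the coordinates lie in [Z_p]. *)
Lemma span_mul u z : isO p u -> span z -> span (mulO u z).
Proof.
move=> hu hz.
have hs : span (fun n => \sum_(k < p) (coordPhi p (u n) k)%:P * ('X^k * z n)).
  by apply: span_sum => k; apply: span_scale (span_mulXn k hz); apply: isZp_coordPhi.
apply: span_eq hs _ _ => [|n]; first by apply: isOM => //; apply: span_isO.
rewrite /mulO; under eq_bigr do rewrite mulrA.
rewrite -mulr_suml; apply: congOM; last exact: congO_refl.
exact/congO_sym/congO_eqPhi/coordPhi_expand.
Qed.

Lemma span_unit u f : unitPhi p u -> span (fun _ => u * f) -> span (fun _ => f).
Proof.
move=> [v [r hr]] /(span_mul (isO_const p v)) hs.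
apply: span_eq hs (isO_const p f) _ => n; exists 0, (r * f).
have -> : v * (u * f) - f = (u * v - 1) * f by ring.
by rewrite hr mulr0 add0r mulrA.
Qed.

End Span.

Section Inclusions.
Variables p a i j : nat.
Hypothesis p_pr : prime p.
Local Notation b := (p + 1 - a)%N.
Local Notation c := (p + 1 - a - a)%N.
Hypothesis a_range : (0 < a < p)%N.
Hypothesis b_range : (0 < b < p)%N.
Local Notation span := (thetaSpan p a i j).
Local Notation N := (vtheta_coef p a i j).
Local Notation eps := (if (p%:Z %| N)%Z then 1%N else 0%N).

(* Modulo [Pi ^+ (i + j).+1], [vtheta (Pi ^+ i * s) (Pi ^+ j * t)] is
   [N * s(1) * t(1) * Pi ^+ (i + j)]. *)
Lemma congO_vtheta_Pi x y n : pideal p i x -> pideal p j y ->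
  exists s, congO p n (vtheta p a (x n) (y n)) (Pi ^+ (i + j + eps) * s).
Proof.
move=> [_ [s [_ hs]]] [_ [t [_ ht]]].
have [g hg] : exists g, congO p n (vtheta_red p a i j (s n) (t n)) (Pi ^+ eps * g).
  case: ifP => [hN|_]; last first.
    by exists (vtheta_red p a i j (s n) (t n)); rewrite mul1r; apply: congO_refl.
  have : (p%:Z %| (vtheta_red p a i j (s n) (t n)).[1])%Z.
    by rewrite horner_vtheta_red1 -mulrA dvdz_mulr.
  by case/eqPhi_Pi_of_dvd_horner1 => // g hg; exists g; apply: congO_eqPhi.
exists g; apply: congO_trans (congO_vtheta p_pr a_range b_range (hs n) (ht n)) _.
by rewrite vtheta_PiX (exprD _ (i + j)) -mulrA; apply: congOMl.
Qed.

Lemma span_sub_pideal z : span z -> pideal p (i + j + eps) z.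
Proof.
move=> [hz [m [c0 [x [y [H ez]]]]]]; apply: pideal_of_congO => // n.
pose inPi f := exists s, congO p n f (Pi ^+ (i + j + eps) * s).
suff [s hs] : inPi (\sum_(k < m) (c0 k n)%:P * varthetaO p a (x k) (y k) n).
  by exists s; apply: congO_trans (ez n) hs.
apply: (@big_ind _ inPi) => [|f g [s1 h1] [s2 h2]|k _].
- by exists 0; rewrite mulr0; apply: congO_refl.
- by exists (s1 + s2); rewrite mulrDr; apply: congOD.
- have [_ [hx hy]] := H k; have [s hs] := congO_vtheta_Pi n hx hy.
  by exists ((c0 k n)%:P * s); rewrite mulrCA; apply: congOMl.
Qed.

Hypothesis c_range : (0 < c < p)%N.

(* [vtheta (Pi ^+ i) ('X * Pi ^+ j) - 'X^a * vtheta (Pi ^+ i) (Pi ^+ j)] is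
   [Pi ^+ (i + j).+1] times a unit. *)
Lemma span_Pi_succ : span (fun _ => Pi ^+ (i + j).+1).
Proof.
pose u : {poly int} := - ('X^a * geom a ^+ i * geom b ^+ j * geom c).
have hu : unitPhi p u.
  apply/unitPhiN/unitPhiM; last exact: unitPhi_geom.
  apply: unitPhiM; [apply: unitPhiM; first exact: unitPhi_Xn |];
    exact/unitPhiX/unitPhi_geom.
apply: (span_unit p_pr a_range b_range hu).
have hv s := span_vtheta p_pr a_range b_range (pideal_const p i 1) (pideal_const p j s).
have hw := spanD (hv 'X) (span_mul p_pr a_range b_range (isO_const p (- 'X^a)) (hv 1)).
apply: span_ext hw _ => n; rewrite /mulO !varthetaOE !vtheta_PiX /vtheta_red.
have hXb : 'X^b = 'X^a * (1 - Pi * geom c) :> {poly int}.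
  by rewrite mulPi_geom subKr -exprD subnKC //; move: c_range; lia.
by rewrite !comp_polyC !comp_polyX hXb /u exprS; ring.
Qed.

Lemma span_Pi : ~~ (p%:Z %| N)%Z -> span (fun _ => Pi ^+ (i + j)).
Proof.
move=> hN; have /coprimezP[[u v] /= huv] : coprimez N p.
  by rewrite /coprimez /gcdz /= gcdnC [_ == _](prime_coprime _ p_pr).
set r := vtheta_red p a i j 1 1.
have : root (r - N%:P) 1.
  by rewrite /root hornerD hornerN hornerC /r horner_vtheta_red1 !hornerC !mulr1 subrr.
case/factor_theorem => q hq; have [T hT] := natp_Phi_Pi p.
have hv := span_vtheta p_pr a_range b_range (pideal_const p i 1) (pideal_const p j 1).
have hs := spanD (span_mul p_pr a_range b_range (isO_const p u%:P) hv)
  (span_mul p_pr a_range b_range (isO_const p (v%:P * T + u%:P * q)) span_Pi_succ).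
apply: span_eq hs (isO_const p _) _ => n; apply/congO_eqPhi.
exists (- (v%:P * Pi ^+ (i + j))); rewrite /mulO varthetaOE vtheta_PiX -/r.
transitivity (Pi ^+ (i + j) * ((u * N + v * p%:Z)%:P - 1) - Phi p * (v%:P * Pi ^+ (i + j))).
  by rewrite -[r](subrK N%:P) hq polyC1 [in RHS]polyCD ![in RHS]polyCM hT exprS /Pi; ring.
by rewrite huv subrr mulr0 sub0r mulrN.
Qed.

Lemma pideal_sub_span z : pideal p (i + j + eps) z -> span z.
Proof.
move=> [hz [y [hy ey]]].
have hPi : span (fun _ => Pi ^+ (i + j + eps)).
  case: ifP => hN; first by rewrite addn1; apply: span_Pi_succ.
  by rewrite addn0; apply: span_Pi; rewrite hN.
apply: span_eq (span_mul p_pr a_range b_range hy hPi) hz _ => n.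
by rewrite /mulO mulrC; apply/congO_sym/ey.
Qed.

Lemma thetaSpan_pideal z : span z <-> pideal p (i + j + eps) z.
Proof. by split; [apply: span_sub_pideal | apply: pideal_sub_span]. Qed.

End Inclusions.

Lemma dvdz_order_vtheta_coef p a o i j : prime p -> (0 < a < p)%N ->
  (0 < p + 1 - a < p)%N -> o.-primitive_root ((a%:R : 'F_p) / (1 - a%:R)) ->
  dvdz o (i%:Z - j%:Z) = (p%:Z %| vtheta_coef p a i j)%Z.
Proof.
move=> p_pr a_range b_range o_prim; set A := (a%:R : 'F_p).
have hB : ((p + 1 - a)%:R : 'F_p) = 1 - A.
  by rewrite natrB ?natrD ?pchar_Fp_0 ?add0r //; lia.
have A_neq0 : A != 0 := Fp_nat_neq0 p_pr a_range.
have B_neq0 : 1 - A != 0 by rewrite -hB Fp_nat_neq0.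
rewrite -[dvdz _ _]/(_ \in dvdz _) -eqz_mod_dvd !modz_nat eqz_nat.
rewrite -(eq_prim_root_expr o_prim) !exprMn !exprVn eqr_div ?expf_neq0 //.
by rewrite -eqz_mod_dvd !modz_nat eqz_nat -Fp_natE // !natrM !natrX hB [(1 - A) ^+ i * _]mulrC.
Qed.

Theorem lemma2p3 (p a oa : nat) :
  prime p -> (5 <= p)%N -> (2 <= a <= (p - 1)./2)%N ->
  (* oa = multiplicative order of a (1 - a)^-1 in (Z/pZ)^* *)
  oa.-primitive_root ((a%:R : 'F_p) / (1 - a%:R)) ->
  (forall (i j : nat) (z : Oseq),
     thetaSpan p a i j z <->
     pideal p (i + j + (if dvdz oa (i%:Z - j%:Z) then 1 else 0))%N z)
  /\ (forall (i : nat) (z : Oseq), thetaSpan p a i i z <-> pideal p (2 * i + 1)%N z)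
  /\ (forall x y : Oseq, isO p x -> isO p y ->
        eqO p (varthetaO p a (mulO thetaO x) (mulO thetaO y))
              (mulO thetaO (varthetaO p a x y))).
Proof.
move=> p_pr p_ge5 /andP[a_ge2]; rewrite geq_half_double => a_le o_prim.
have a_range : (0 < a < p)%N by lia.
have b_range : (0 < p + 1 - a < p)%N by lia.
have c_range : (0 < p + 1 - a - a < p)%N by lia.
have main i j z : thetaSpan p a i j z <->
    pideal p (i + j + (if dvdz oa (i%:Z - j%:Z) then 1 else 0))%N z.
  by rewrite (dvdz_order_vtheta_coef _ _ p_pr a_range b_range o_prim) thetaSpan_pideal.
split; first exact: main.
split=> [i z | x y _ _ n]; first by rewrite main subrr /dvdz dvdn0 addnn -mul2n.
exact/congO_eqPhi/vtheta_mulX.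
Qed.
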